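(* Let $\Gamma=(\mathcal N,(Y_i,u_i)_{i\in\mathcal N})$ be a finite normal-form game with $\mathcal{N}=\{1,\dots,N\}$, let $Z\subset\mathbb R^m$ be compact, and let $\Psi=(\{\gamma(n)\}_{n\ge 1},g,(f_i)_{i=1}^N)$ be a FP-type algorithm such that (a) $g:\Delta(Y)\to Z$ is uniformly continuous; (b) $\gamma(n)>0$ for all $n$, $\lim_{n\to\infty}\gamma(n)=0$ and $\sum_{n\ge1}\gamma(n)=\infty$; (c) for each $i\in\mathcal N$ the forecast map $f_i:Z\to\Delta(Y_{-i})$ is continuous. Suppose that the set-valued map $F(z):=g(BR_f(z))-z$, $z\in Z$, has closed graph, has nonempty compact convex values, and satisfies $\sup_{\eta\in F(z)}\|\eta\|\le c(1+\|z\|)$ for all $z\in Z$, for some $c>0$. Let $\{\epsilon_n\}_{n\ge1}$ be a sequence of nonnegative numbers with $\lim_{n\to\infty}\epsilon_n=0$, and let $\{\sigma(n)\}_{n\ge1}$ and $\{z(n)\}_{n\ge1}$ form a weakened FP-type process, i.e. $z(n)\in Z$ for all $n$ and, for all $n\ge1$, $$\sigma(n+1)\in BR_{f,\epsilon_n}(z(n)),\qquad z(n+1)=z(n)+\gamma(n)\big(g(\sigma(n+1))-z(n)\big).$$ Then $\{z(n)\}$ converges to the chain recurrent set of the differential inclusion $$\dot z(t)\in g(BR_f(z(t)))-z(t),$$ in the sense that the set of limit points of $\{z(n)\}_{n\ge1}$ is contained in an internally chain recurrent set of this differential inclusion.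
   Context: Game notation. $Y_i$ is the finite action set of player $i$, $Y=\prod_{i}Y_i$, $Y_{-i}=\prod_{j\ne i}Y_j$, $u_i:Y\to\mathbb R$ is the utility of player $i$. For a finite set $X$, $\Delta(X)$ is the set of probability distributions on $X$. For $x\in\Delta(Y)$, $U_i(x)=\sum_{y\in Y}u_i(y)x(y)$. For $x_i\in\Delta(Y_i)$ and $x_{-i}\in\Delta(Y_{-i})$ (possibly correlated), $U_i(x_i,x_{-i})$ is the expected utility under the product of $x_i$ and $x_{-i}$. For $\epsilon\ge0$, $$BR_{i,\epsilon}(x_{-i})=\{\tilde x_i\in\Delta(Y_i): U_i(\tilde x_i,x_{-i})\ge\max_{x_i\in\Delta(Y_i)}U_i(x_i,x_{-i})-\epsilon\},\qquad BR_i=BR_{i,0}.$$ FP-type algorithm. $Z$ is the observation space, $g$ the observation map, $f_i$ the forecast map of player $i$, $z(n)$ the observation state, with $z(1)\in Z$ arbitrary. Write $f=(f_1,\dots,f_N)$ and $$BR_f(z)=\prod_{i=1}^N BR_i(f_i(z)),\qquad BR_{f,\epsilon}(z)=\prod_{i=1}^N BR_{i,\epsilon}(f_i(z)).$$ An $N$-tuple $(p_1,\dots,p_N)$ with $p_i\in\Delta(Y_i)$ is identified with the product distribution in $\Delta(Y)$, so these sets are subsets of $\Delta(Y)$. Also $g(BR_f(z))-z=\{g(x)-z:x\in BR_f(z)\}$. Solutions and internal chain recurrence. A solution of $\dot z\in F(z)$ is an absolutely continuous curve $x$ with $\dot x(t)\in F(x(t))$ for almost every $t$. For a set $X\subseteq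 Z$ and points $\xi,\eta$, write $\xi\hookrightarrow\eta$ if for every $\epsilon>0$ and $T>0$ there exist an integer $k\ge1$, solutions $x_1,\dots,x_k$, and real numbers $t_1,\dots,t_k>T$ such that (i) $x_i(s)\in X$ for all $0\le s\le t_i$ and all $i=1,\dots,k$; (ii) $\|x_i(t_i)-x_{i+1}(0)\|\le\epsilon$ for $i=1,\dots,k-1$; (iii) $\|x_1(0)-\xi\|\le\epsilon$ and $\|x_k(t_k)-\eta\|\le\epsilon$. Since $F$ is defined only on $Z$, the curves $x_i$ are only considered on $[0,t_i]$, where they lie in $X\subseteq Z$. The set $X$ is internally chain recurrent if $X$ is compact and $\xi\hookrightarrow\xi'$ for all $\xi,\xi'\in X$. *)

(* Defs.v *)
From HB Require Import structures.
From mathcomp Require Import all_boot all_order all_algebra.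
From mathcomp Require Import all_classical all_reals all_analysis.

Set Implicit Arguments.
Unset Strict Implicit.
Unset Printing Implicit Defensive.

Import Order.TTheory GRing.Theory Num.Theory.
Import numFieldNormedType.Exports.

Local Open Scope classical_set_scope.
Local Open Scope ring_scope.

(* Real-valued functions on a finite type X are encoded as row vectors indexed
   by the enumeration of X, so that they form a normed space. *)
Notation vec R X := 'rV[R]_#|X|.

Section Distributions.
Context {R : realType}.

Definition coef (X : finType) (x : vec R X) (a : X) : R := x ord0 (enum_rank a).

Definition of_fun (X : finType) (h : X -> R) : vec R X :=
  \row_k h (enum_val k).

Definition Delta (X : finType) : set (vec R X) :=
  [set x | (forall a, 0 <= coef x a) /\ \sum_(a : X) coef x a = 1].

End Distributions.
Arguments Delta : clear implicits.

Section Game.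
Context {R : realType} {N : nat}.
Variable Y : 'I_N -> finType.

Definition profile : finType := {dffun forall j : 'I_N, Y j}.

Definition others (i : 'I_N) : finType :=
  {dffun forall j : {j : 'I_N | j != i}, Y (val j)}.

Definition restrict (i : 'I_N) (y : profile) : others i :=
  [ffun j : {j : 'I_N | j != i} => y (val j)].

Definition prod_pair (i : 'I_N) (xi : vec R (Y i)) (xo : vec R (others i)) :
    vec R profile :=
  of_fun (fun y : profile => coef xi (y i) * coef xo (restrict i y)).

Definition prod_dist (p : forall i : 'I_N, vec R (Y i)) : vec R profile :=
  of_fun (fun y : profile => \prod_(i < N) coef (p i) (y i)).

Variable u : 'I_N -> profile -> R.

Definition expected_utility (i : 'I_N) (x : vec R profile) : R :=
  \sum_(y : profile) u i y * coef x y.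

Definition expected_utility_pair (i : 'I_N) (xi : vec R (Y i))
    (xo : vec R (others i)) : R :=
  expected_utility i (prod_pair xi xo).

(* The sup is a max: the expected utility is affine on the compact set
   Delta (Y i). *)
Definition BR_eps (eps : R) (i : 'I_N) (xo : vec R (others i)) :
    set (vec R (Y i)) :=
  [set xi | Delta R (Y i) xi /\
    expected_utility_pair xi xo >=
      sup [set expected_utility_pair x xo | x in Delta R (Y i)] - eps].

Section Forecast.
Variables (m : nat) (f : forall i : 'I_N, 'rV[R]_m -> vec R (others i)).

Definition BRf_eps (eps : R) (z : 'rV[R]_m) : set (vec R profile) :=
  [set prod_dist p | p in
    [set p : forall i, vec R (Y i) | forall i, BR_eps eps (f i z) (p i)]].

Definition BRf : 'rV[R]_m -> set (vec R profile) := BRf_eps 0.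

Definition FP_map (g : vec R profile -> 'rV[R]_m) (z : 'rV[R]_m) :
    set 'rV[R]_m :=
  [set g x - z | x in BRf z].

End Forecast.
End Game.

(* The norm on 'rV[R]_m is the max norm; all norms on R^m are equivalent and
   each notion below is unchanged if another one is used. *)
Section DifferentialInclusion.
Context {R : realType} {m : nat}.

Definition absolutely_continuous (a b : R) (x : R -> 'rV[R]_m) : Prop :=
  forall eps : R, 0 < eps -> exists2 delta : R, 0 < delta &
    forall (n : nat) (l r : 'I_n -> R),
      (forall i, a <= l i /\ l i <= r i /\ r i <= b) ->
      trivIset [set: 'I_n] (fun i => `]l i, r i[%classic) ->
      \sum_(i < n) (r i - l i) < delta ->
      \sum_(i < n) `|x (r i) - x (l i)| < eps.

Definition solution_on (F : 'rV[R]_m -> set 'rV[R]_m) (T : R)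
    (x : R -> 'rV[R]_m) : Prop :=
  absolutely_continuous 0 T x /\
  {ae @lebesgue_measure R, forall t, `[0, T]%classic t ->
     derivable x t 1 /\ F (x t) (derive1 x t)}.

Definition chain_to (F : 'rV[R]_m -> set 'rV[R]_m) (X : set 'rV[R]_m)
    (xi eta : 'rV[R]_m) : Prop :=
  forall eps T : R, 0 < eps -> 0 < T ->
  exists (k : nat) (x : nat -> R -> 'rV[R]_m) (t : nat -> R),
    [/\ (1 <= k)%N,
        forall i, (1 <= i <= k)%N -> T < t i /\ solution_on F (t i) (x i),
        forall i, (1 <= i <= k)%N -> forall s, 0 <= s <= t i -> X (x i s),
        forall i, (1 <= i < k)%N -> `|x i (t i) - x i.+1 0| <= eps &
        `|x 1%N 0 - xi| <= eps /\ `|x k (t k) - eta| <= eps].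

(* Only the values of F on Z matter, since X lies in Z. *)
Definition internally_chain_recurrent (Z : set 'rV[R]_m)
    (F : 'rV[R]_m -> set 'rV[R]_m) (X : set 'rV[R]_m) : Prop :=
  [/\ X `<=` Z, compact X & forall xi eta, X xi -> X eta -> chain_to F X xi eta].

End DifferentialInclusion.

(* Main.v *)
From HB Require Import structures.
Require Import Defs.
From mathcomp Require Import all_boot all_order all_algebra.
From mathcomp Require Import all_classical all_reals all_analysis.
From mathcomp Require Import ring lra.

Set Implicit Arguments.
Unset Strict Implicit.
Unset Printing Implicit Defensive.

Import Order.TTheory GRing.Theory Num.Theory.
Import numFieldNormedType.Exports.

Local Open Scope classical_set_scope.
Local Open Scope ring_scope.

(** Call L the set of limit points of the process; it is shown to be internally
    chain recurrent itself.

    Put tau n = gamma 1 + ... + gamma (n - 1) and run the process in continuous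
    time, staying at z n while t lies between tau n and tau (n + 1). Only values
    of the process are visited, so the path zbar stays in Z although Z need not
    be convex. The increment of z over a block of indices is the elapsed time
    multiplied by a convex combination of the velocities
    v n = g (sigma (n + 1)) - z n, and these are bounded since Z is. As gamma
    tends to 0, zbar is therefore nearly Lipschitz at late times, and a limit x
    of the shifted paths zbar (a + .) along an ultrafilter of times a tending to
    infinity exists pointwise by compactness of Z, is Lipschitz, takes its
    values in L, and is a uniform limit on every segment.

    Such an x solves the inclusion. A Lipschitz curve is derivable almost
    everywhere ([ae_derivable_lipschitz_rV]). Where it is, its difference
    quotient over a short interval is a limit of averages of velocities v n with
    z n close to x s; each of them is close to F (x s), because a limit of
    eps-best responses with eps tending to 0 is an exact best response
    ([BRf_limit], [response_near_FP_map]). As F (x s) is convex and closed, the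
    averages are close to it too and the derivative belongs to it.

    Hence every late piece of zbar of bounded duration is shadowed by a solution
    inside L. The process comes back infinitely often close to each
    point of L, so two points xi and eta of L are joined by a piece of zbar
    that is late, long, and starts near xi and ends near eta; cut into equal
    parts of duration larger than T and shadowed part by part, it is the
    required chain ([limit_set_internally_chain_recurrent]). *)

(** * Almost everywhere derivability of Lipschitz curves *)

(** The Stieltjes measures of F and G add up to Lebesgue measure, since they do
    so on intervals; so each of them vanishes where Lebesgue measure does. *)
Lemma stieltjes_null_dominates (R : realType) (F G : cumulative R R) :
  (forall t : R, F t + G t = t) ->
  lebesgue_stieltjes_measure F `<< @lebesgue_measure R.
Proof.
move=> FG; apply/null_content_dominatesP => A mA A0.
have itvE : forall X : set R, ocitv X -> @lebesgue_measure R X =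
    measure_add (lebesgue_stieltjes_measure F)
      (lebesgue_stieltjes_measure G) X.
  move=> X /ocitvP oX.
  rewrite measure_addE.
  case: oX => [->|[[a b]/= ab ->]]; first by rewrite !measure0 adde0.
  rewrite /lebesgue_measure /lebesgue_stieltjes_measure /measure_extension.
  rewrite !measurable_mu_extE/=; try exact: is_ocitv.
  rewrite !wlength_itv_bnd ?(ltW ab)//= -EFinD; congr EFin.
  by rewrite -{1}(FG a) -{1}(FG b); ring.
have /esym := lebesgue_measure_unique itvE mA.
rewrite A0 [LHS](measure_addE (lebesgue_stieltjes_measure F)
  (lebesgue_stieltjes_measure G)) => /eqP.
by rewrite padde_eq0// => /andP[/eqP].
Qed.

(** By the Radon-Nikodym theorem the Stieltjes measure of F has a density with
    respect to Lebesgue measure, so F is locally an indefinite integral, and is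
    derivable at every Lebesgue point of the density. *)
Lemma ae_derivable_cumulative (R : realType) (F G : cumulative R R) (a b : R) :
  (forall t : R, F t + G t = t) ->
  {ae @lebesgue_measure R, forall t, t \in `]a, b[ -> derivable F t 1}.
Proof.
move=> FG.
pose nu : {measure set (measurableTypeR R) -> \bar R} :=
  lebesgue_stieltjes_measure F.
have mD : measurable (`]a, b]%classic : set (measurableTypeR R)).
  exact: measurable_itv.
have nuE c d : c <= d -> nu `]c, d]%classic = (F d - F c)%:E.
  move=> cd; rewrite /nu /= /lebesgue_stieltjes_measure /measure_extension.
  by rewrite measurable_mu_extE/= ?wlength_itv_bnd//; exact: is_ocitv.
have nuD : (nu `]a, b]%classic < +oo)%E.
  have [ab|ba] := leP a b; first by rewrite nuE// ltry.
  rewrite set_itv_ge; first by rewrite /nu measure0 ltry.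
  by rewrite bnd_simp -leNgt ltW.
have dom : mfrestr mD nuD `<< @lebesgue_measure R.
  apply/null_content_dominatesP => A mA A0.
  rewrite /mfrestr /mrestr.
  apply: (subset_measure0 (B := A)) => //; first exact: measurableI.
  exact: (null_content_dominatesP _ _).1 (stieltjes_null_dominates FG) A mA A0.
have [f [_ ffin intf fE]] := @radon_nikodym_sigma_finite _ _ _
  (@lebesgue_measure R) (mfrestr mD nuD) dom.
pose h := fine \o f.
have fh : EFin \o h = f by apply/funext => t /=; rewrite fineK.
have inth : (@lebesgue_measure R).-integrable setT (EFin \o h) by rewrite fh.
have := lebesgue_differentiation (open_integrable_locally openT inth).
apply: (@filterS _ _ (ae_filter_ringOfSetsType (@lebesgue_measure R))).
move=> t lt; rewrite in_itv /= => /andP[aT tb].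
have := @FTC1_lebesgue_pt R h (BRight a) t b tb.
move=> /(_ (integrableS measurableT mD (@subsetT _ _) inth)) /=.
rewrite lte_fin => /(_ aT lt) [dF _].
set H := (fun y => _) in dF.
have HF y : y \in `]a, b[ -> H y = F y - F a.
  rewrite in_itv/= => /andP[ay yb]; rewrite /H /Rintegral.
  have -> : [set` Interval (BRight a) (BRight y)] = `]a, y]%classic by [].
  rewrite -[X in fine X]/(integral lebesgue_measure _ (EFin \o h)) fh -fE//=.
  rewrite /mfrestr /mrestr.
  rewrite (_ : _ `&` _ = `]a, y]%classic); first by rewrite nuE ?ltW.
  apply/seteqP; split => [s []//|s sy]; split => //.
  by apply: subset_itvl sy; rewrite bnd_simp ltW.
have dHa : derivable (H + cst (F a)) t 1.
  by apply: derivableD => //; exact: derivable_cst.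
apply: near_eq_derivable dHa => //.
have tab : t \in `]a, b[ by rewrite in_itv/= aT tb.
near=> y; rewrite /GRing.add/= HF ?subrK//.
by near: y; exact: near_in_itvoo.
Unshelve. all: by end_near. Qed.

Lemma coord_norm_le (R : realType) (m : nat) (v : 'rV[R]_m) (j : 'I_m) :
  `|v ord0 j| <= `|v|.
Proof.
rewrite [leRHS]/Num.Def.normr/= mx_normrE.
exact: (le_bigmax _ (fun k : 'I_1 * 'I_m => `|v k.1 k.2|) (ord0, j)).
Qed.

Lemma lipschitz_continuous (R : realType) (V : normedModType R) (M : R)
    (x : R -> V) :
  (forall s t, `|x s - x t| <= M * `|s - t|) -> continuous x.
Proof.
move=> xM t; apply/cvgrPdist_le => e e0.
have M0 : 0 < `|M| + 1 by rewrite ltr_pwDr.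
near=> s.
apply: (le_trans (xM _ _)).
apply: (@le_trans _ _ ((`|M| + 1) * `|t - s|)).
  by rewrite ler_wpM2r// (le_trans (ler_norm _))// lerDl.
rewrite mulrC -ler_pdivlMr//; near: s.
by apply: cvgr_dist_le; rewrite ?divr_gt0//; exact: cvg_id.
Unshelve. all: by end_near. Qed.

(** The functions (t + f t / M) / 2 and (t - f t / M) / 2 are nondecreasing when
    f is M-Lipschitz, and they add up to t; and f is a combination of the
    first one and the identity. *)
Lemma ae_derivable_lipschitz (R : realType) (M : R) (f : R -> R) (a b : R) :
  0 < M -> (forall s t, `|f s - f t| <= M * `|s - t|) ->
  {ae @lebesgue_measure R, forall t, t \in `]a, b[ -> derivable f t 1}.
Proof.
move=> M0 fM; have cf := lipschitz_continuous fM.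
pose F0 c t := (t + c * f t) / 2.
have rcF c : right_continuous (F0 c).
  apply: right_continuousW => t; apply: cvgM; last exact: cvg_cst.
  by apply: cvgD; [exact: cvg_id|apply: cvgM; [exact: cvg_cst|exact: cf]].
have ndF c : `|c| = M^-1 -> nondecreasing (F0 c).
  move=> cM s t st; rewrite ler_pM2r ?invr_gt0// -subr_ge0.
  have -> : t + c * f t - (s + c * f s) = t - s + c * (f t - f s) by ring.
  rewrite -lerBlDl sub0r.
  have : `|c * (f t - f s)| <= t - s.
    rewrite normrM cM mulrC ler_pdivrMr// mulrC.
    by rewrite -[X in _ * X]ger0_norm ?subr_ge0.
  by rewrite ler_norml => /andP[].
have cM1 : `|M^-1| = M^-1 by rewrite gtr0_norm ?invr_gt0.
have cM2 : `|- M^-1| = M^-1 by rewrite normrN.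
pose F : cumulative R R := HB.pack (F0 M^-1)
  (isCumulative.Build R _ R (F0 M^-1) (ndF _ cM1) (rcF _)).
pose G : cumulative R R := HB.pack (F0 (- M^-1))
  (isCumulative.Build R _ R (F0 (- M^-1)) (ndF _ cM2) (rcF _)).
have FG t : F t + G t = t.
  by rewrite /F /G /= /F0; field; rewrite gt_eqF.
have := ae_derivable_cumulative a b FG.
apply: (@filterS _ _ (ae_filter_ringOfSetsType (@lebesgue_measure R))).
move=> t + tab => /(_ tab) dF.
have -> : f = M *: ((2 : R) *: (F : R -> R) - id).
  apply/funext => s; rewrite /F /= /GRing.scale/= /GRing.add/= /GRing.opp/=.
  rewrite /GRing.scale/= /F0; field.
  by rewrite gt_eqF.
by apply: derivableZ; apply: derivableB => //; exact: derivableZ.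
Qed.

Lemma ae_derivable_lipschitz_rV (R : realType) (m : nat) (M : R)
    (x : R -> 'rV[R]_m) (a b : R) :
  0 < M -> (forall s t, `|x s - x t| <= M * `|s - t|) ->
  {ae @lebesgue_measure R, forall t, t \in `]a, b[ -> derivable x t 1}.
Proof.
move=> M0 xM.
have coord (j : 'I_m) : {ae @lebesgue_measure R,
    forall t, t \in `]a, b[ -> derivable (fun s => x s ord0 j) t 1}.
  apply: (@ae_derivable_lipschitz _ M) => // s t.
  apply: le_trans (xM s t).
  by have := coord_norm_le (x s - x t) j; rewrite !mxE.
have : \forall t \ae @lebesgue_measure R, forall j : 'I_m,
    t \in `]a, b[ -> derivable (fun s => x s ord0 j) t 1.
  by apply: filter_forall.
apply: (@filterS _ _ (ae_filter_ringOfSetsType (@lebesgue_measure R))).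
move=> t dt tab; apply/derivable_mxP => i j; rewrite ord1; exact: dt.
Qed.

Lemma lipschitz_absolutely_continuous (R : realType) (m : nat) (M a b : R)
    (x : R -> 'rV[R]_m) :
  0 < M -> (forall s t, `|x s - x t| <= M * `|s - t|) ->
  absolutely_continuous a b x.
Proof.
move=> M0 xM e e0; exists (e / M); first by rewrite divr_gt0.
move=> n l r lr _; rewrite ltr_pdivlMr// mulrC; apply: le_lt_trans.
rewrite mulr_sumr; apply: ler_sum => i _.
have [_ [lri _]] := lr i.
by rewrite (le_trans (xM _ _))// ger0_norm// subr_ge0.
Qed.

Lemma solution_on_sub (R : realType) (m : nat) (F : 'rV[R]_m -> set 'rV[R]_m)
    (S T : R) (x : R -> 'rV[R]_m) :
  S <= T -> solution_on F T x -> solution_on F S x.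
Proof.
move=> ST [acx solx]; split.
  move=> e /acx[d d0 dx]; exists d => // n l r lr; apply: dx => i.
  by have [al [? ?]] := lr i; split => //; split => //; exact: le_trans ST.
move: solx.
apply: (@filterS _ _ (ae_filter_ringOfSetsType (@lebesgue_measure R))).
move=> t solt; rewrite /= in_itv/= => /andP[t0 tS].
by apply: solt; rewrite /= in_itv/= t0 (le_trans tS).
Qed.

(** * Convexity and ultrafilter limits *)

Lemma fmap_ultra (T T' : Type) (h : T -> T') (U : set_system T) :
  UltraFilter U -> UltraFilter (h @ U).
Proof.
move=> UU; split; first exact: fmap_proper_filter.
move=> G GF UG; apply/seteqP; split => // A GA.
have [//|UnA] := in_ultra_setVsetC (h @^-1` A) UU.
have /filter_ex [y []//] : G (A `&` ~` A) by apply: filterI => //; exact: UG.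
Qed.

Lemma ultra_cvg_compact (T : Type) (X : topologicalType) (K : set X)
    (h : T -> X) (U : set_system T) :
  UltraFilter U -> compact K -> (\forall a \near U, K (h a)) ->
  exists2 y, K y & h a @[a --> U] --> y.
Proof.
move=> UU; rewrite compact_ultra => Kc hK.
by have [y [Ky hy]] := Kc _ (fmap_ultra h UU) hK; exists y.
Qed.

Lemma convex_set_combination (R : realType) (V : lmodType R) (C : set V)
    (x y : V) (l : R) :
  convex_set C -> C x -> C y -> 0 <= l <= 1 -> C (l *: x + (1 - l) *: y).
Proof.
move=> Cconv Cx Cy /andP[l0 l1].
have := Cconv x y (Itv01 l0 l1).
by move=> /(_ (mem_set Cx) (mem_set Cy))/set_mem.
Qed.

(** * The limit set of a recursion with vanishing steps *)

Section LimitSet.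
Context {R : realType} {m : nat}.
Variables (Z : set 'rV[R]_m) (F : 'rV[R]_m -> set 'rV[R]_m).
Variables (gam : nat -> R) (z v : nat -> 'rV[R]_m) (M : R).
Hypothesis Z_compact : compact Z.
Hypothesis z_in : forall n, Z (z n).
Hypothesis gam_gt0 : forall n, 0 < gam n.
Hypothesis gam_cvg0 : gam n @[n --> \oo] --> (0 : R).
Hypothesis gam_div : \sum_(0 <= k < n) gam k @[n --> \oo] --> +oo.
Hypothesis z_rec : forall n, z n.+1 = z n + gam n *: v n.
Hypothesis M_gt0 : 0 < M.
Hypothesis v_le : forall n, `|v n| <= M.
Hypothesis F_closed : forall x, Z x -> closed (F x).
Hypothesis F_convex : forall x, Z x -> convex_set (F x).
(** The velocities v n are only asymptotically in F: they approach F x0 when z n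
    approaches x0 and n is large. This also encodes the upper
    semicontinuity of F along the process. *)
Hypothesis v_near_F : forall x (e : R), Z x -> 0 < e ->
  exists2 d : R, 0 < d & \forall n \near \oo,
    `|z n - x| < d -> exists2 c, F x c & `|v n - c| <= e.

Let tau n := \sum_(0 <= k < n) gam k.

Let tauS n : tau n.+1 = tau n + gam n.
Proof. by rewrite /tau big_nat_recr. Qed.

Let tau_le i j : (i <= j)%N -> tau i <= tau j.
Proof.
apply: (@homo_leq _ tau <=%R) => //; first exact: le_trans.
by move=> n; rewrite tauS lerDl ltW.
Qed.

Let tau_near (t : R) : \forall n \near \oo, t < tau n.
Proof. by move: gam_div => /cvgryPgt /(_ t). Qed.

Let clock_subproof (t : R) : exists n, t < tau n.+1.
Proof.
have [n _ /(_ n.+1)] := tau_near t.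
by rewrite /= leqnSn => /(_ isT) tn; exists n.
Qed.

(** The index reached by the process at time t. *)
Let clock (t : R) : nat := ex_minn (clock_subproof t).

Let tau_clock_gt t : t < tau (clock t).+1.
Proof. by rewrite /clock; case: ex_minnP. Qed.

Let clock_min t n : t < tau n.+1 -> (clock t <= n)%N.
Proof. by rewrite /clock; case: ex_minnP => k _; apply. Qed.

Let tau_clock_le t : 0 <= t -> tau (clock t) <= t.
Proof.
move=> t0; case E : (clock t) => [|n]; first by rewrite /tau big_nil.
by rewrite leNgt; apply/negP => /clock_min; rewrite E ltnn.
Qed.

Let clock_homo s t : s <= t -> (clock s <= clock t)%N.
Proof. by move=> st; apply: clock_min; exact: le_lt_trans (tau_clock_gt t). Qed.

Let clock_tau n : clock (tau n) = n.
Proof.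
apply/eqP; rewrite eqn_leq clock_min ?tauS ?ltrDl//= leqNgt.
apply/negP => /tau_le; apply/negP; rewrite -ltNge.
exact: tau_clock_gt.
Qed.

Let clock_ge n : \forall t \near +oo, (n <= clock t)%N.
Proof.
near=> t; rewrite -(clock_tau n); apply: clock_homo.
by near: t; apply: nbhs_pinfty_ge; rewrite num_real.
Unshelve. all: by end_near. Qed.

(** A step function rather than the usual affine interpolation: its values are
    terms of the sequence, hence points of Z. *)
Let zbar (t : R) := z (clock t).

Let z_incr p q : (p <= q)%N -> `|z q - z p| <= M * (tau q - tau p).
Proof.
move=> /subnK <-; elim: (q - p)%N => [|k IH].
  by rewrite add0n !subrr normr0 mulr0.
rewrite addSn z_rec tauS addrAC (le_trans (ler_normD _ _))//.
rewrite [X in _ <= _ * X]addrAC mulrDr lerD// normrZ gtr0_norm// mulrC.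
by rewrite ler_wpM2r// ltW.
Qed.

Let small_steps (e : R) : 0 < e -> \forall t \near +oo, gam (clock t) <= e.
Proof.
move=> e0; have [n _ gn] := (cvgrPdist_le _ _).1 gam_cvg0 _ e0.
near=> t; have := gn (clock t).
rewrite /= sub0r normrN gtr0_norm//; apply.
by near: t; exact: clock_ge.
Unshelve. all: by end_near. Qed.

Let tau_clock_ge t : t <= tau (clock t) + gam (clock t).
Proof. by rewrite -tauS ltW. Qed.

Let zbar_incr s t : 0 <= s -> 0 <= t ->
  `|zbar t - zbar s| <= M * (`|t - s| + (gam (clock s) + gam (clock t))).
Proof.
wlog st : s t / s <= t => [hw s0 t0|s0 t0].
  have [/hw|/ltW /hw] := leP s t; first exact.
  by move=> /(_ t0 s0); rewrite distrC (distrC s) (addrC (gam (clock t))).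
apply: (le_trans (z_incr (clock_homo st))).
rewrite ler_wpM2l ?(ltW M_gt0)// ger0_norm ?subr_ge0//.
have := tau_clock_le t0; have := tau_clock_ge s; have := gam_gt0 (clock t).
lra.
Qed.

(** Over a block of indices, the increment of z divided by the elapsed time is a
    convex combination of the velocities; so it is as close to a convex set
    as they are. *)
Let mean_velocity (C : set 'rV[R]_m) (e : R) p q : convex_set C -> 0 <= e ->
  (p < q)%N ->
  (forall k, (p <= k < q)%N -> exists2 c, C c & `|v k - c| <= e) ->
  exists2 c, C c & `|z q - z p - (tau q - tau p) *: c| <= e * (tau q - tau p).
Proof.
move=> Cconv e0 /subnKC <-; elim: (q - p.+1)%N => [|k IH] Hv.
  have [|c Cc vc] := Hv p; first by rewrite addn0 leqnn /=.
  exists c => //; rewrite addn0 z_rec tauS [_ - z p]addrAC subrr add0r.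
  rewrite [tau p + _]addrC addrK -scalerBr normrZ gtr0_norm// mulrC.
  by rewrite ler_wpM2r// ltW.
have [|c Cc zc] := IH.
  by move=> j /andP[pj jk]; apply: Hv; rewrite pj addnS ltnS ltnW.
have [|c' Cc' vc'] := Hv (p.+1 + k)%N.
  by rewrite addnS ltnSn andbT addSn ltnW// ltnS leq_addr.
rewrite addnS; set q' := (p.+1 + k)%N in zc vc' *.
have pq : tau p < tau q'.
  rewrite (@lt_le_trans _ _ (tau p.+1))//; first by rewrite tauS ltrDl.
  by apply: tau_le; rewrite leq_addr.
set D := tau q' - tau p; have D0 : 0 < D by rewrite subr_gt0.
have g0 := gam_gt0 q'.
have Dg0 : 0 < D + gam q' by rewrite addr_gt0.
have l01 : 0 <= D / (D + gam q') <= 1.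
  by rewrite divr_ge0 ?(ltW D0) ?(ltW Dg0)//= ler_pdivrMr// mul1r lerDl ltW.
exists ((D / (D + gam q')) *: c + (1 - D / (D + gam q')) *: c').
  exact: convex_set_combination.
rewrite z_rec tauS [tau q' + _ - _]addrAC -/D.
rewrite scalerDr !scalerA mulrBr mulr1 mulrCA divff ?mulr1 ?gt_eqF//.
rewrite [D + _ - D]addrAC subrr add0r.
rewrite mulrDr.
have -> : z q' + gam q' *: v q' - z p - (D *: c + gam q' *: c') =
    (z q' - z p - D *: c) + gam q' *: (v q' - c').
  rewrite scalerBr opprD !addrA; congr (_ - _).
  by rewrite [RHS]addrAC; congr (_ - _); rewrite addrAC.
rewrite (le_trans (ler_normD _ _))// lerD// normrZ gtr0_norm// mulrC.
by rewrite ler_wpM2r// ltW.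
Qed.
Let L := cluster (z n @[n --> \oo]).

Let L_sub : L `<=` Z.
Proof.
move=> x; rewrite /L clusterE => /(_ Z) /=.
have /closure_id <- := compact_closed (@norm_hausdorff _ _) Z_compact.
by apply; exists 0%N => // n _; exact: z_in.
Qed.

Let L_compact : compact L.
Proof.
apply: subclosed_compact L_sub => //; rewrite /L clusterE.
by apply: closed_bigI => A _; exact: closed_closure.
Qed.

Let L_frequently x (e : R) n : L x -> 0 < e ->
  exists2 k, (n <= k)%N & `|z k - x| <= e.
Proof.
move=> Lx e0.
have [||y [[k nk <-] yx]] := Lx (z @` [set k | (n <= k)%N]) (ball x e).
- by exists n => // k nk; exists k.
- exact: nbhsx_ballx.
- by exists k => //; move: yx; rewrite -ball_normE/= distrC => /ltW.
Qed.

(** ** Limits of time shifts along an ultrafilter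

    An ultrafilter replaces the extraction of a subsequence: all the limits
    exist at once, and uniformity follows from equicontinuity. *)

Section LimitCurve.
Variable U : set_system R.
Hypothesis U_ultra : UltraFilter U.
Hypothesis U_pinfty : pinfty_nbhs R `<=` U.

Let U_near (P : R -> Prop) :
  (\forall a \near +oo, P a) -> \forall a \near U, P a.
Proof. exact: U_pinfty. Qed.

Let U_shift (P : R -> Prop) s :
  (\forall a \near +oo, P a) -> \forall a \near U, P (a + s).
Proof.
move=> [A [Ar AP]]; apply: U_near.
exists (A - s); split; first by rewrite num_real.
by move=> a; rewrite ltrBlDr => /AP.
Qed.

Lemma limit_curve_ex : exists x : R -> 'rV[R]_m,
  forall s, zbar (a + s) @[a --> U] --> x s.
Proof.
suff ex s : exists y : 'rV[R]_m, zbar (a + s) @[a --> U] --> y.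
  by have [x zx] := choice ex; exists x.
have [|y _ zy] :=
    ultra_cvg_compact (h := fun a => zbar (a + s)) U_ultra Z_compact.
  by apply: nearW => a; exact: z_in.
by exists y.
Qed.

Variable x : R -> 'rV[R]_m.
Hypothesis zx : forall s, zbar (a + s) @[a --> U] --> x s.

Let U_close s (e : R) : 0 < e -> \forall a \near U, `|x s - zbar (a + s)| <= e.
Proof. by move=> e0; move/cvgrPdist_le : (@zx s) => /(_ e e0). Qed.

Lemma limit_curve_in s : L (x s).
Proof.
move=> A B zA xB.
have [n _ An] := zA.
have /filter_ex [a [Ba na]] : \forall a \near U,
    B (zbar (a + s)) /\ (n <= clock (a + s))%N.
  by apply: filterI; [exact: zx|exact: (U_shift s (clock_ge n))].
by exists (zbar (a + s)); split => //; exact: An.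
Qed.

Let U_nonneg s : \forall a \near U, 0 <= a + s.
Proof.
by apply: (@U_shift (fun t => 0 <= t)); apply: nbhs_pinfty_ge; rewrite num_real.
Qed.

Let limit_curve_lipschitz s t : `|x s - x t| <= M * `|s - t|.
Proof.
apply/ler_addgt0Pr => e e0.
have e4 : 0 < e / 4 by rewrite divr_gt0.
have eM4 : 0 < e / (4 * M) by rewrite divr_gt0 ?mulr_gt0.
near U => a.
have as0 : 0 <= a + s by near: a; exact: U_nonneg.
have at0 : 0 <= a + t by near: a; exact: U_nonneg.
have xs : `|x s - zbar (a + s)| <= e / 4 by near: a; exact: U_close.
have xt : `|x t - zbar (a + t)| <= e / 4 by near: a; exact: U_close.
have gs : gam (clock (a + s)) <= e / (4 * M).
  by near: a; exact: U_shift s (small_steps eM4).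
have gt : gam (clock (a + t)) <= e / (4 * M).
  by near: a; exact: U_shift t (small_steps eM4).
have := zbar_incr at0 as0.
have -> : a + s - (a + t) = s - t by ring.
have -> : x s - x t = (x s - zbar (a + s)) + (zbar (a + s) - zbar (a + t))
    - (x t - zbar (a + t)).
  by rewrite !subrKA opprB addrA subrK.
move=> zst; rewrite (le_trans (ler_normB _ _))//.
have := ler_normD (x s - zbar (a + s)) (zbar (a + s) - zbar (a + t)).
have : M * (gam (clock (a + t)) + gam (clock (a + s))) <= e / 2.
  have -> : e / 2 = M * (e / (4 * M) + e / (4 * M)) by field; rewrite gt_eqF.
  by rewrite ler_pM2l// lerD.
lra.
Unshelve. all: by end_near. Qed.

(** Since zbar is nearly equi-Lipschitz at late times, the pointwise
    convergence is locally uniform in s, hence uniform on the compact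
    segment from 0 to T. *)
Lemma limit_curve_shadow (T e : R) : 0 < e ->
  \forall a \near U, forall s, 0 <= s <= T -> `|zbar (a + s) - x s| <= e.
Proof.
move=> e0; have := @segment_compact R 0 T.
move=> /compact_near_coveringP /(_ R U (fun a s => `|zbar (a + s) - x s| <= e)).
have e4 : 0 < e / 4 by rewrite divr_gt0.
have eM8 : 0 < e / (8 * M) by rewrite divr_gt0 ?mulr_gt0.
have eM4 : 0 < e / (4 * M) by rewrite divr_gt0 ?mulr_gt0.
have UF : Filter U by exact: filter_filter.
move=> /(_ UF) H; apply: filterS (H _) => [a Ha s sT|s sT].
  by apply: Ha; rewrite /= in_itv.
have [A [Ar Ag]] := small_steps eM8.
(* The margin 1 in the times keeps a + s' late for all s' near s. *)
exists ([set s' | `|s - s'| < Num.min 1 (e / (4 * M))],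
  [set a | `|x s - zbar (a + s)| <= e / 4 /\
    (0 <= a + s - 1 /\ A < a + s - 1)]).
  split.
    have r0 : 0 < Num.min 1 (e / (4 * M)) by rewrite lt_min ltr01.
    by have := nbhsx_ballx s _ r0; rewrite -ball_normE.
  apply: filterI; first exact: U_close.
  apply: filterI; near=> a; rewrite -addrA; near: a.
    exact: U_nonneg.
  by apply: (@U_shift (fun t => A < t)); exact: nbhs_pinfty_gt.
move=> [s' a]/= [ss' [xs [as0 Aas]]].
move: ss'; rewrite lt_min => /andP[ss1 sse].
have s's : - 1 < s' - s by move: ss1; rewrite distrC ltr_norml => /andP[].
have asA : A < a + s by lra.
have as'A : A < a + s' by lra.
have as0' : 0 <= a + s by lra.
have as'0 : 0 <= a + s' by lra.
have gs := Ag _ asA; have gs' := Ag _ as'A.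
have := zbar_incr as0' as'0.
have -> : a + s' - (a + s) = s' - s by ring.
have xx := limit_curve_lipschitz s s'.
have -> : zbar (a + s') - x s' = (zbar (a + s') - zbar (a + s))
    - (x s - zbar (a + s)) + (x s - x s').
  by rewrite opprB !subrKA.
move=> zz; rewrite (le_trans (ler_normD _ _))//.
have := ler_normB (zbar (a + s') - zbar (a + s)) (x s - zbar (a + s)).
have : M * (gam (clock (a + s)) + gam (clock (a + s'))) <= e / 4.
  have -> : e / 4 = M * (e / (8 * M) + e / (8 * M)) by field; rewrite gt_eqF.
  by rewrite ler_pM2l// lerD.
have : M * `|s - s'| <= e / 4.
  have -> : e / 4 = M * (e / (4 * M)) by field; rewrite gt_eqF.
  by rewrite ler_pM2l// ltW.
move: zz; rewrite [`|s' - s|]distrC.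
lra.
Unshelve. all: by end_near. Qed.

(** The derivative v0 is close to a difference quotient of x over a short time
    h, which is close to a difference quotient of zbar over the same time.
    During that time zbar stays near x s, so all velocities involved are near
    F (x s), and so is their mean. The duration h is chosen first, for the
    derivative and for the distance to x s; then the step size g0, negligible
    with respect to h. *)
Let limit_curve_derive s : derivable x s 1 -> F (x s) (derive1 x s).
Proof.
move=> dx; set v0 := derive1 x s.
have Zx := L_sub (@limit_curve_in s).
apply: (F_closed Zx) => B /nbhs_ballP[e /= e0 eB].
have e8 : 0 < e / 8 by rewrite divr_gt0.
have [d d0 [n0 _ vF]] := v_near_F Zx e8.
have dv : h^-1 *: (x (h + s) - x s) @[h --> 0^'] --> v0.
  rewrite /v0 derive1E; under eq_fun do rewrite -[X in x (X + s)]mulr1.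
  exact: dx.
have [r /= r0 vr] := (cvgrPdist_le _ _).1 dv _ e8.
have dM4 : 0 < d / (4 * M) by rewrite divr_gt0 ?mulr_gt0.
pose h := Num.min (r / 2) (d / (4 * M)).
have h0 : 0 < h by rewrite lt_min dM4 andbT divr_gt0.
have hr : h < r by rewrite gt_min ltr_pdivrMr// ltr_pMr// ltr1n.
have hd : M * h <= d / 4.
  have -> : d / 4 = M * (d / (4 * M)) by field; rewrite gt_eqF.
  by rewrite ler_pM2l// ge_min lexx orbT.
have {}vr : `|h *: v0 - (x (h + s) - x s)| <= e / 8 * h.
  have := vr h; rewrite /= sub0r normrN gtr0_norm// => /(_ hr (lt0r_neq0 h0)).
  rewrite -(ler_pM2r h0); congr (_ <= _).
  rewrite mulrC -{1}(gtr0_norm h0) -normrZ scalerBr scalerA divff ?gt_eqF//.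
  by rewrite scale1r.
have v1 : 0 < `|v0| + 1 by rewrite ltr_wpDl.
pose g0 := Num.min (h / 2) (Num.min (h * (e / 8) / (`|v0| + 1)) (d / (4 * M))).
have g00 : 0 < g0 by rewrite !lt_min dM4 !divr_gt0// mulr_gt0.
have g0h : g0 <= h / 2 by rewrite ge_min lexx.
have g0v : g0 * `|v0| <= e / 8 * h.
  apply: (@le_trans _ _ (g0 * (`|v0| + 1))).
    by rewrite ler_pM2l// lerDl.
  by rewrite -ler_pdivlMr// [e / 8 * h]mulrC !ge_min lexx !orbT.
have g0d : M * g0 <= d / 4.
  have -> : d / 4 = M * (d / (4 * M)) by field; rewrite gt_eqF.
  by rewrite ler_pM2l// !ge_min lexx !orbT.
have eh : 0 < e / 8 * h / 2 by rewrite !divr_gt0// mulr_gt0// divr_gt0.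
have d4 : 0 < d / 4 by rewrite divr_gt0.
(* A single late time a is enough, for all the estimates hold eventually. *)
near U => a.
have as0 : 0 <= a + s by near: a; exact: U_nonneg.
have ash0 : 0 <= a + (h + s) by near: a; exact: U_nonneg.
have xs : `|x s - zbar (a + s)| <= e / 8 * h / 2 by near: a; exact: U_close.
have xsd : `|x s - zbar (a + s)| <= d / 4 by near: a; exact: U_close.
have xsh : `|x (h + s) - zbar (a + (h + s))| <= e / 8 * h / 2.
  by near: a; exact: U_close.
have gs : gam (clock (a + s)) <= g0.
  by near: a; exact: U_shift s (small_steps g00).
have gsh : gam (clock (a + (h + s))) <= g0.
  by near: a; exact: U_shift (h + s) (small_steps g00).
have n0s : (n0 <= clock (a + s))%N by near: a; exact: (U_shift s (clock_ge n0)).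
move: xs xsd xsh gs gsh n0s; rewrite /zbar.
have := tau_clock_le as0; have := tau_clock_le ash0.
have := tau_clock_ge (a + s); have := tau_clock_ge (a + (h + s)).
set p := clock (a + s); set q := clock (a + (h + s)).
move=> tq1 tp1 tq2 tp2 xs xsd xsh gs gsh n0s.
have tpq : tau p < tau q by lra.
have pq : (p < q)%N by rewrite ltnNge; apply/negP => /tau_le; rewrite leNgt tpq.
have [|c Fc zc] := mean_velocity (F_convex Zx) (ltW e8) pq.
  move=> k /andP[pk kq]; apply: vF; first exact: leq_trans n0s pk.
  have := z_incr pk; have : tau k - tau p <= h + g0.
    by have := tau_le (ltnW kq); lra.
  rewrite -(ler_pM2l M_gt0) mulrDr => kp zkp.
  have -> : z k - x s = (z k - z p) - (x s - z p) by rewrite opprB subrKA.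
  by have := ler_normB (z k - z p) (x s - z p); lra.
exists c; split => //; apply: eB; rewrite -ball_normE /=.
have D0 : 0 < tau q - tau p by rewrite subr_gt0.
rewrite -(ltr_pM2l D0) -{1}(gtr0_norm D0) -normrZ.
set D := tau q - tau p in zc D0 *.
(* The five terms have norms at most e/8 h, e/8 h, e/16 h, e/16 h and e/8 D;
   as h <= 2 D, the total is at most 7/8 e D. *)
have -> : D *: (v0 - c) = (D - h) *: v0 + (h *: v0 - (x (h + s) - x s))
    + (x (h + s) - z q) - (x s - z p) + (z q - z p - D *: c).
  by apply/rowP => j; rewrite !mxE; ring.
have t1 : `|(D - h) *: v0| <= e / 8 * h.
  rewrite normrZ (le_trans _ g0v)// ler_wpM2r// ler_norml /D.
  by apply/andP; split; lra.
apply: (le_lt_trans (ler_normD _ _)).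
have := ler_normB ((D - h) *: v0 + (h *: v0 - (x (h + s) - x s))
    + (x (h + s) - z q)) (x s - z p).
have := ler_normD ((D - h) *: v0 + (h *: v0 - (x (h + s) - x s)))
    (x (h + s) - z q).
have := ler_normD ((D - h) *: v0) (h *: v0 - (x (h + s) - x s)).
have hD : h <= 2 * D by rewrite /D; lra.
have : e / 8 * h <= e / 8 * (2 * D) by rewrite ler_pM2l.
have : 0 < e / 8 * D by rewrite mulr_gt0.
lra.
Unshelve. all: by end_near. Qed.

Lemma limit_curve_solution (T : R) : solution_on F T x.
Proof.
split; first exact: lipschitz_absolutely_continuous M_gt0 limit_curve_lipschitz.
(* An open interval around the segment takes care of the endpoints. *)
have := ae_derivable_lipschitz_rV (- 1) (T + 1) M_gt0 limit_curve_lipschitz.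
apply: (@filterS _ _ (ae_filter_ringOfSetsType (@lebesgue_measure R))).
move=> t dx; rewrite /= in_itv/= => /andP[t0 tT].
have {}dx : derivable x t 1.
  apply: dx; rewrite in_itv/= (lt_le_trans _ t0) ?ltrN10//=.
  by rewrite (le_lt_trans tT)// ltrDl.
by split => //; exact: limit_curve_derive.
Qed.

End LimitCurve.

(** Otherwise there would be an ultrafilter of arbitrarily late times at which
    shadowing fails, whereas the limit curve along that ultrafilter shadows
    zbar. *)
Let shadowing (T e : R) : 0 < e -> \forall a \near +oo,
  exists x : R -> 'rV[R]_m, [/\ solution_on F T x, forall s, L (x s) &
    forall s, 0 <= s <= T -> `|zbar (a + s) - x s| <= e].
Proof.
move=> e0; set P := (fun a => exists x, _); apply: contrapT => nP.
have B_proper : ProperFilter (within (~` P) (pinfty_nbhs R)).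
  split; last exact: within_filter.
  move=> B0; apply: nP.
  have {}B0 : \forall a \near +oo, (~` P) a -> set0 a := B0.
  apply: filterS B0 => a /= nPa.
  by apply: contrapT => /nPa.
have [U [U_ultra BU]] := ultraFilterLemma B_proper.
have U_pinfty : pinfty_nbhs R `<=` U.
  by move=> A AA; apply: BU; apply: filterS AA => a Aa _.
have [x zx] := limit_curve_ex U_ultra.
have UP : U P.
  have := limit_curve_shadow U_ultra U_pinfty zx T e0.
  apply: filterS => a xa; exists x; split => //.
    exact: (@limit_curve_solution U U_ultra U_pinfty x zx T).
  exact: (@limit_curve_in U U_ultra U_pinfty x zx).
have UnP : U (~` P) by apply: BU; exact: withinT.
by have /filter_ex [a []] : U (P `&` ~` P) by exact: filterI.
Qed.

Let limit_set_chain xi eta : L xi -> L eta -> chain_to F L xi eta.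
Proof.
move=> Lxi Leta e T e0 T0.
have e2 : 0 < e / 2 by rewrite divr_gt0.
have T1 : 0 < T + 1 by rewrite addr_gt0.
have [A [_ shadow]] := shadowing (2 * (T + 1)) e2.
have [X HX] : exists X : R -> R -> 'rV[R]_m, forall a, A < a ->
    [/\ solution_on F (2 * (T + 1)) (X a), forall s, L (X a s) &
      forall s, 0 <= s <= 2 * (T + 1) -> `|zbar (a + s) - X a s| <= e / 2].
  suff ex a : exists x : R -> 'rV[R]_m, A < a ->
      [/\ solution_on F (2 * (T + 1)) x, forall s, L (x s) &
      forall s, 0 <= s <= 2 * (T + 1) -> `|zbar (a + s) - x s| <= e / 2].
    by have [X HX] := choice ex; exists X.
  have [/shadow [x xP]|_] := ltP A a; first by exists x.
  by exists (fun=> 0).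
have [N1 _ AN1] := tau_near A.
have [n1 N1n1 zn1] := L_frequently N1 Lxi e2.
have [N2 _ nN2] := tau_near (tau n1 + (T + 1)).
have [n2 N2n2 zn2] := L_frequently N2 Leta e2.
have {AN1 N1n1} An1 : A < tau n1 by exact: AN1.
have {nN2 N2n2} n12 : tau n1 + (T + 1) < tau n2 by exact: nN2.
pose W := tau n2 - tau n1; have WT : T + 1 < W by rewrite /W; lra.
(* The elapsed time W is cut into k parts of the same duration h. Taking k as
   large as W >= k (T + 1) permits makes h at most twice T + 1, the duration for
   which shadowing has been prepared. *)
pose k := Num.truncn (W / (T + 1)).
have W0 : 0 <= W / (T + 1) by rewrite divr_ge0// ltW// (lt_trans T1).
have /andP[kW Wk] := truncn_itv W0; rewrite -/k in kW Wk.
have k1 : (1 <= k)%N.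
  by rewrite /k truncn_gt0 ler_pdivlMr// mul1r ltW.
have k0 : 0 < k%:R :> R by rewrite ltr0n.
pose h := W / k%:R.
have hk : h * k%:R = W by rewrite /h divfK// gt_eqF.
have hT : T + 1 <= h by rewrite ler_pdivlMr// mulrC -ler_pdivlMr.
have h2T : h <= 2 * (T + 1).
  rewrite ler_pdivrMr// mulrAC -ler_pdivrMr//.
  rewrite (le_trans (ltW Wk))// -natr1 mulr_natl mulr2n lerD2l.
  by rewrite (ler_nat R 1).
have h0 : 0 < h by exact: lt_le_trans hT.
(* Chains are indexed from 1, so part i starts after i - 1 durations. *)
pose a i := tau n1 + i.-1%:R * h.
have aA i : A < a i by rewrite (lt_le_trans An1)// lerDl mulr_ge0// ltW.
exists k, (fun i => X (a i)), (fun=> h).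
have h_in : 0 <= h <= 2 * (T + 1) by rewrite (ltW h0).
have zero_in : 0 <= (0 : R) <= 2 * (T + 1) by rewrite lexx (le_trans (ltW h0)).
have aS i : (1 <= i)%N -> a i + h = a i.+1.
  by case: i => // i _; rewrite /a /= -addrA -(natr1 i) mulrDl mul1r.
split => //.
- move=> i _; have [sol _ _] := HX _ (aA i).
  by split; [lra|exact: solution_on_sub sol].
- by move=> i _ s _; have [_ + _] := HX _ (aA i); exact.
- move=> i /andP[i1 _]; have [_ _ /(_ _ h_in)] := HX _ (aA i).
  have [_ _ /(_ _ zero_in)] := HX _ (aA i.+1).
  rewrite addr0 aS// => z1 z2.
  rewrite -(subrKA (zbar (a i.+1))) (le_trans (ler_normD _ _))//.
  by rewrite (splitr e) lerD// distrC.
- split.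
    have [_ _ /(_ _ zero_in)] := HX _ (aA 1%N).
    rewrite /a /= mul0r !addr0 /zbar clock_tau => z1.
    rewrite -(subrKA (z n1)) (le_trans (ler_normD _ _))//.
    by rewrite (splitr e) lerD// distrC.
  have [_ _ /(_ _ h_in)] := HX _ (aA k).
  have -> : a k + h = tau n2.
    by rewrite aS// /a /= mulrC hk /W addrC subrK.
  rewrite /zbar clock_tau => z1.
  rewrite -(subrKA (z n2)) (le_trans (ler_normD _ _))//.
  by rewrite (splitr e) lerD// distrC.
Qed.

Lemma limit_set_internally_chain_recurrent :
  internally_chain_recurrent Z F (cluster (z n @[n --> \oo])).
Proof. by split; [exact: L_sub|exact: L_compact|exact: limit_set_chain]. Qed.

End LimitSet.

(** * Distributions, product distributions and utilities *)

Section DistributionTopology.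
Context {R : realType}.

Lemma cvg_sumr (T : Type) (U : set_system T) (I : finType) (h : T -> I -> R)
    (l : I -> R) : Filter U -> (forall i, h t i @[t --> U] --> l i) ->
  \sum_i h t i @[t --> U] --> \sum_i l i.
Proof.
move=> UF hl.
have add_cont : continuous (fun x : R * R => x.1 + x.2).
  by move=> x; apply: cvgD; [exact: cvg_fst|exact: cvg_snd].
by apply: (@cvg_big R I +%R 0 xpredT add_cont T U (index_enum I)
  (fun i t => h t i)).
Qed.

Lemma cvg_prodr (T : Type) (U : set_system T) (I : finType) (h : T -> I -> R)
    (l : I -> R) : Filter U -> (forall i, h t i @[t --> U] --> l i) ->
  \prod_i h t i @[t --> U] --> \prod_i l i.
Proof.
move=> UF hl.
have mul_cont : continuous (fun x : R * R => x.1 * x.2).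
  by move=> x; apply: cvgM; [exact: cvg_fst|exact: cvg_snd].
by apply: (@cvg_big R I *%R 1 xpredT mul_cont T U (index_enum I)
  (fun i t => h t i)).
Qed.

Lemma coef_continuous (X : finType) (a : X) :
  continuous (fun x : vec R X => coef x a).
Proof. exact: coord_continuous. Qed.

Lemma cvg_coef (T : Type) (U : set_system T) (X : finType)
    (h : T -> vec R X) (x : vec R X) (a : X) :
  Filter U -> h t @[t --> U] --> x -> coef (h t) a @[t --> U] --> coef x a.
Proof.
move=> UF hx.
apply: (@cvg_comp _ _ _ h (fun y => coef y a) U (nbhs x)) => //.
exact: coef_continuous.
Qed.

Lemma of_funK (X : finType) (h : X -> R) a : coef (of_fun h) a = h a.
Proof. by rewrite /coef /of_fun mxE enum_rankK. Qed.

Lemma cvg_of_fun (T : Type) (U : set_system T) (X : finType)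
    (h : T -> X -> R) (l : X -> R) :
  Filter U -> (forall a, h t a @[t --> U] --> l a) ->
  of_fun (h t) @[t --> U] --> of_fun l.
Proof.
move=> UF hl; apply/cvgrPdist_le => e e0.
have H : \forall t \near U, forall a : X, `|l a - h t a| <= e.
  by apply: filter_forall => a; move/cvgrPdist_le : (hl a) => /(_ e e0).
apply: filterS H => t Ht.
rewrite [leLHS]/Num.Def.normr/= mx_normrE.
apply: (bigmax_le _ (ltW e0)) => /= k _.
by rewrite !mxE.
Qed.

Lemma Delta_coef_le1 (X : finType) (x : vec R X) a :
  Delta R X x -> coef x a <= 1.
Proof.
by move=> [x0 <-]; rewrite (bigD1 a)//= lerDl sumr_ge0.
Qed.

Lemma Delta_compact (X : finType) : compact (Delta R X).
Proof.
pose box := [set x : vec R X | forall k, `[0, 1]%classic (x ord0 k)].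
have box_compact : compact box.
  apply: (@rV_compact R _ (fun=> `[0, 1]%classic)) => k.
  exact: segment_compact.
apply: (subclosed_compact _ box_compact).
  have -> : Delta R X =
      \bigcap_(a in setT) ((coef (X := X))^~ a @^-1` [set t | 0 <= t])
      `&` (fun x => \sum_(a : X) coef x a) @^-1` [set 1].
    by apply/seteqP; split => x [x0 x1]; split => // a; [move=> _|]; exact: x0.
  apply: closedI.
    apply: closed_bigI => a _; apply: preimage_closed; last exact: closed_ge.
    by move=> x _; exact: coef_continuous.
  apply: preimage_closed; last exact: closed_eq.
  move=> x _; apply: (cvg_sumr (U := nbhs x)) => a.
  exact: coef_continuous.
move=> x Dx k /=; rewrite in_itv/=.
have := Delta_coef_le1 (enum_val k) Dx; have := Dx.1 (enum_val k).
by rewrite /coef enum_valK => -> ->.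
Qed.

End DistributionTopology.

Section ProductDistributions.
Context {R : realType} {N : nat}.
Variable Y : 'I_N -> finType.

(** Distributivity of products over sums for dependent choices y i in Y i: the
    profiles are first identified with sections of the disjoint union of the
    Y i, where the non-dependent form applies. *)
Lemma sum_prod_profile (h : forall i : 'I_N, Y i -> R) :
  \sum_(y : profile Y) \prod_(i < N) h i (y i) =
  \prod_(i < N) \sum_(a : Y i) h i a.
Proof.
rewrite (reindex (@dffun_of_fprod _ Y)); last exact/onW_bij/dffun_of_fprod_bij.
pose P_ i := [ffun a => h i a].
transitivity (\sum_(t : fprod Y) \prod_(i in 'I_N) P_ i (t i)).
  apply: eq_bigr => t _; apply: eq_bigr => i _.
  by rewrite /P_ ffunE /dffun_of_fprod ffunE.
rewrite big_fprod.
transitivity (\prod_(i < N) \sum_(j in tagged_with Y i) untag 0 (P_ i) j).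
  by rewrite bigA_distr_big_dep.
apply: eq_bigr => i _; rewrite -(big_tag P_).
by apply: eq_bigr => a _; rewrite ffunE.
Qed.

Lemma prod_dist_Delta (p : forall i : 'I_N, vec R (Y i)) :
  (forall i, Delta R (Y i) (p i)) -> Delta R (profile Y) (prod_dist p).
Proof.
move=> pD; split.
  by move=> y; rewrite of_funK prodr_ge0// => i _; exact: (pD i).1.
under eq_bigr do rewrite of_funK.
rewrite (sum_prod_profile (fun i a => coef (p i) a)) big1// => i _.
exact: (pD i).2.
Qed.

Lemma cvg_prod_dist (T : Type) (U : set_system T)
    (p : T -> forall i : 'I_N, vec R (Y i)) (q : forall i, vec R (Y i)) :
  Filter U -> (forall i, p t i @[t --> U] --> q i) ->
  prod_dist (p t) @[t --> U] --> prod_dist q.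
Proof.
move=> UF pq; apply: cvg_of_fun => y.
apply: cvg_prodr => i.
exact: cvg_coef.
Qed.

Variable u : 'I_N -> profile Y -> R.

Lemma cvg_expected_utility_pair (T : Type) (U : set_system T) i
    (xi : T -> vec R (Y i)) (xo : T -> vec R (others Y i)) yi yo :
  Filter U -> xi t @[t --> U] --> yi -> xo t @[t --> U] --> yo ->
  expected_utility_pair u (xi t) (xo t) @[t --> U] -->
  expected_utility_pair u yi yo.
Proof.
move=> UF xyi xyo.
apply: cvg_sumr => y.
apply: cvgM; first exact: cvg_cst.
rewrite of_funK; under eq_fun do rewrite of_funK.
by apply: cvgM; exact: cvg_coef.
Qed.

Lemma has_ubound_utility i (xo : vec R (others Y i)) :
  Delta R (others Y i) xo ->
  has_ubound [set expected_utility_pair u x xo | x in Delta R (Y i)].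
Proof.
move=> Dxo; exists (\sum_(y : profile Y) `|u i y|) => _ [x Dx <-].
apply: ler_sum => y _; rewrite of_funK (le_trans (ler_norm _))// normrM.
rewrite ler_piMr// ger0_norm; last by rewrite mulr_ge0// ?Dx.1 ?Dxo.1.
by rewrite mulr_ile1 ?Dx.1 ?Dxo.1 ?Delta_coef_le1.
Qed.

(** Each comparison with a fixed alternative y passes to the limit; the supremum
    bounds such a comparison because utilities are bounded. *)
Lemma BR_eps_limit (T : topologicalType) (U : set_system T) i (e : T -> R)
    (xi : T -> vec R (Y i)) (xo : T -> vec R (others Y i)) yi yo :
  ProperFilter U -> (\forall t \near U, Delta R (others Y i) (xo t)) ->
  Delta R (Y i) yi -> (\forall t \near U, BR_eps u (e t) (xo t) (xi t)) ->
  e t @[t --> U] --> 0 ->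
  xi t @[t --> U] --> yi -> xo t @[t --> U] --> yo ->
  BR_eps u 0 yo yi.
Proof.
move=> UF Dxo Dyi br e0 xyi xyo; split => //.
rewrite subr0; apply: ge_sup.
  by exists (expected_utility_pair u yi yo), yi.
move=> _ [y Dy <-].
have lhs : expected_utility_pair u y (xo t) - e t @[t --> U] -->
    expected_utility_pair u y yo.
  rewrite -[X in _ --> X]subr0; apply: cvgB => //.
  by apply: cvg_expected_utility_pair => //; exact: cvg_cst.
have rhs := cvg_expected_utility_pair UF xyi xyo.
apply: (ler_cvg_to lhs rhs).
apply: filterS2 Dxo br => t Dt [_]; apply: le_trans.
rewrite lerD2r; apply: ub_le_sup; first exact: has_ubound_utility.
by exists y.
Qed.

End ProductDistributions.

(** * Approximate best responses approach the exact ones *)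

Lemma unif_continuous_continuous (V W : uniformType) (h : V -> W) :
  unif_continuous h -> continuous h.
Proof.
move=> hu x; apply/cvg_entourageP => A entA.
by apply: filterS (nbhs_entourage x (hu A entA)) => y; rewrite /xsection/= inE.
Qed.

Lemma cvg_within_continuous (I : Type) (U : set_system I)
    (V W : topologicalType) (D : set V) (h : V -> W) (y : I -> V) (l : V) :
  Filter U -> {within D, continuous h} -> D l -> (\forall t \near U, D (y t)) ->
  y t @[t --> U] --> l -> h (y t) @[t --> U] --> h l.
Proof.
move=> UF /subspace_continuousP hD Dl Dy yl B hB.
have := yl _ (hD l Dl B hB).
by apply: filterS2 Dy => t Dt; exact.
Qed.

Section BestResponseLimit.
Context {R : realType} {N m : nat}.
Variable Y : 'I_N -> finType.
Variable u : 'I_N -> profile Y -> R.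
Variable Z : set 'rV[R]_m.
Variable g : vec R (profile Y) -> 'rV[R]_m.
Variable f : forall i : 'I_N, 'rV[R]_m -> vec R (others Y i).
Hypothesis f_range : forall i z, Z z -> Delta R (others Y i) (f i z).
Hypothesis f_cont : forall i, {within Z, continuous (f i)}.
Hypothesis g_cont : {within Delta R (profile Y), continuous g}.

Lemma BRf_eps_Delta e z : BRf_eps u f e z `<=` Delta R (profile Y).
Proof. by move=> _ [p br <-]; apply: prod_dist_Delta => i; exact: (br i).1. Qed.

(** The closed graph property of the best response map, with the tolerance
    tending to 0. The limit of s exists because the mixed actions of which s
    is the product converge along the ultrafilter. *)
Lemma BRf_limit (T : topologicalType) (U : set_system T) (e : T -> R)
    (z : T -> 'rV[R]_m) (s : T -> vec R (profile Y)) z0 :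
  UltraFilter U -> (forall t, Z (z t)) -> Z z0 ->
  (forall t, BRf_eps u f (e t) (z t) (s t)) ->
  e t @[t --> U] --> 0 -> z t @[t --> U] --> z0 ->
  exists2 s0, BRf u f z0 s0 & s t @[t --> U] --> s0.
Proof.
move=> UU zZ Z0 sBR e0 zz0.
have [p pP] := choice (fun t => let: ex_intro2 p br ps := sBR t in
  ex_intro (fun p => (forall i, BR_eps u (e t) (f i (z t)) (p i)) /\
    prod_dist p = s t) p (conj br ps)).
have limp i : exists2 q, Delta R (Y i) q & p t i @[t --> U] --> q.
  apply: (ultra_cvg_compact UU (@Delta_compact R (Y i))).
  by apply: nearW => t; exact: ((pP t).1 i).1.
pose q i := sval (cid2 (limp i)).
have qD i : Delta R (Y i) (q i) by rewrite /q; case: cid2.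
have pq i : p t i @[t --> U] --> q i by rewrite /q; case: cid2.
have UF : Filter U by exact: filter_filter.
exists (prod_dist q).
  exists q => // i; apply: (BR_eps_limit (U := U) (e := e)
    (xi := fun t => p t i) (xo := fun t => f i (z t))) => //.
  - by apply: nearW => t; exact: f_range.
  - by apply: nearW => t; exact: (pP t).1.
  - apply: (cvg_within_continuous UF (@f_cont i)) => //; exact: nearW.
have -> : s = fun t => prod_dist (p t) by apply/funext => t; rewrite (pP t).2.
exact: cvg_prod_dist.
Qed.

(** Otherwise some indices n k tending to infinity have z (n k) tending to z0
    and velocities far from F z0; but by [BRf_limit] the velocities
    accumulate in F z0. *)
Lemma response_near_FP_map (e : nat -> R) (z : nat -> 'rV[R]_m)
    (s : nat -> vec R (profile Y)) z0 (r : R) :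
  (forall n, Z (z n)) -> Z z0 -> (forall n, BRf_eps u f (e n) (z n) (s n)) ->
  e n @[n --> \oo] --> 0 -> 0 < r ->
  exists2 d : R, 0 < d & \forall n \near \oo, `|z n - z0| < d ->
    exists2 c, FP_map u f g z0 c & `|g (s n) - z n - c| <= r.
Proof.
move=> zZ Z0 sBR e0 r0; apply: contrapT => nH.
have bad (k : nat) : exists n, [/\ (k <= n)%N, `|z n - z0| < k.+1%:R^-1 &
    ~ exists2 c, FP_map u f g z0 c & `|g (s n) - z n - c| <= r].
  apply: contrapT => nbad; apply: nH.
  exists k.+1%:R^-1; first by rewrite invr_gt0.
  exists k => // n /= kn zn; apply: contrapT => nc; apply: nbad.
  by exists n.
have [n nP] := choice bad.
have n_oo : n k @[k --> \oo] --> \oo.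
  move=> A [k0 _ kA]; exists k0 => // k /= k0k; apply: kA => /=.
  by apply: leq_trans k0k _; have [] := nP k.
have zn0 : z (n k) @[k --> \oo] --> z0.
  apply/cvgrPdist_lt => d d0; near=> k; rewrite distrC.
  have [_ zk _] := nP k; rewrite (lt_trans zk)//.
  by near: k; exact: near_infty_natSinv_lt (PosNum d0).
have [U [UU ooU]] := ultraFilterLemma (@eventually_filter).
have UF : Filter U by exact: filter_filter.
have zU : z (n k) @[k --> U] --> z0 by move=> A /zn0 /ooU.
have eU : e (n k) @[k --> U] --> 0.
  by move=> A /e0 /n_oo /ooU.
have [s0 s0BR ss0] := BRf_limit UU (fun k => zZ (n k)) Z0
  (fun k => sBR (n k)) eU zU.
have gs : g (s (n k)) @[k --> U] --> g s0.
  apply: (cvg_within_continuous UF g_cont) => //.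
    exact: BRf_eps_Delta s0BR.
  by apply: nearW => k; exact: BRf_eps_Delta (sBR (n k)).
have vU : g (s (n k)) - z (n k) @[k --> U] --> g s0 - z0 by exact: cvgB.
have /filter_ex [k vk] : \forall k \near U,
    `|g s0 - z0 - (g (s (n k)) - z (n k))| <= r.
  by move/cvgrPdist_le : vU => /(_ r r0).
have [_ _] := nP k; apply; exists (g s0 - z0); first by exists s0.
by rewrite distrC.
Unshelve. all: by end_near. Qed.

End BestResponseLimit.

(** * Convergence of weakened fictitious play *)

Theorem theorem4p1 (R : realType) (N m : nat)
    (Y : 'I_N -> finType) (u : 'I_N -> profile Y -> R)
    (Z : set 'rV[R]_m) (Z_compact : compact Z)
    (gamma : nat -> R)
    (g : vec R (profile Y) -> 'rV[R]_m)
    (g_range : forall x, Delta R (profile Y) x -> Z (g x))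
    (f : forall i : 'I_N, 'rV[R]_m -> vec R (others Y i))
    (f_range : forall i z, Z z -> Delta R (others Y i) (f i z))
    (g_unif : unif_continuous (g : subspace (Delta R (profile Y)) -> 'rV[R]_m))
    (gamma_gt0 : forall n, (1 <= n)%N -> 0 < gamma n)
    (gamma_cvg0 : gamma n @[n --> \oo] --> (0 : R))
    (gamma_div : \sum_(1 <= k < n) gamma k @[n --> \oo] --> +oo)
    (f_cont : forall i, {within Z, continuous (f i)})
    (F_closed_graph :
      closed [set p : 'rV[R]_m * 'rV[R]_m | Z p.1 /\ FP_map u f g p.1 p.2])
    (F_nonempty : forall z, Z z -> FP_map u f g z !=set0)
    (F_compact : forall z, Z z -> compact (FP_map u f g z))
    (F_convex : forall z, Z z -> convex_set (FP_map u f g z))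
    (F_growth : exists2 c : R, 0 < c & forall z, Z z ->
      (ereal_sup [set (`|eta|)%:E | eta in FP_map u f g z]
         <= (c * (1 + `|z|))%:E)%E)
    (eps : nat -> R)
    (eps_ge0 : forall n, (1 <= n)%N -> 0 <= eps n)
    (eps_cvg0 : eps n @[n --> \oo] --> (0 : R))
    (sigma : nat -> vec R (profile Y)) (z : nat -> 'rV[R]_m)
    (z_in : forall n, (1 <= n)%N -> Z (z n))
    (sigma_BR : forall n, (1 <= n)%N -> BRf_eps u f (eps n) (z n) (sigma n.+1))
    (z_rec : forall n, (1 <= n)%N ->
      z n.+1 = z n + gamma n *: (g (sigma n.+1) - z n)) :
  exists2 X : set 'rV[R]_m,
    internally_chain_recurrent Z (FP_map u f g) X &
    cluster (z n @[n --> \oo]) `<=` X.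
Proof.
have g_cont : {within Delta R (profile Y), continuous g}.
  exact: unif_continuous_continuous g_unif.
have /pinfty_ex_gt0 [B B0 /= zB] := compact_bounded Z_compact.
(* The process starts at 1, the recursion above at 0: indices are shifted. *)
pose v n := g (sigma n.+2) - z n.+1.
have sigmaZ n : Z (g (sigma n.+2)).
  by apply: g_range; exact: BRf_eps_Delta (sigma_BR n.+1 isT).
have vM n : `|v n| <= B + B.
  by rewrite (le_trans (ler_normB _ _))// lerD// zB//; exact: z_in.
have B2 : 0 < B + B by rewrite addr_gt0.
have gam_cvg0 : gamma n.+1 @[n --> \oo] --> (0 : R) by rewrite cvg_shiftS.
have eps1_cvg0 : eps n.+1 @[n --> \oo] --> (0 : R) by rewrite cvg_shiftS.
have gam_div : \sum_(0 <= k < n) gamma k.+1 @[n --> \oo] --> +oo.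
  have -> : (fun n => \sum_(0 <= k < n) gamma k.+1) =
      (fun n => \sum_(1 <= k < n.+1) gamma k).
    by apply/funext => n; rewrite big_add1.
  by rewrite (cvg_shiftS (fun n => \sum_(1 <= k < n) gamma k)).
have := @limit_set_internally_chain_recurrent R m Z (FP_map u f g)
  (fun n => gamma n.+1) (fun n => z n.+1) v (B + B) Z_compact
  (fun n => z_in n.+1 isT)
  (fun n => gamma_gt0 n.+1 isT) gam_cvg0 gam_div
  (fun n => z_rec n.+1 isT) B2 vM.
have Fclosed x : Z x -> closed (FP_map u f g x).
  by move=> /F_compact; exact: compact_closed (@norm_hausdorff _ _).
move=> /(_ Fclosed F_convex) X_icr.
exists (cluster (z n.+1 @[n --> \oo])).
  apply: X_icr => x e Zx e0.
  apply: (response_near_FP_map f_range f_cont g_cont (e := fun n => eps n.+1)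
    (z := fun n => z n.+1) (s := fun n => sigma n.+2)) => //.
  - by move=> n; exact: z_in.
  - by move=> n; exact: sigma_BR.
move=> x zx A B' zA xB; apply: zx xB.
have [n0 _ An] := zA; exists n0.+1 => // -[//|n] /=.
by rewrite ltnS => /An.
Qed.
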